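(* Assume: (a) for every $x\in\mathsf X$, if $a_n\to a$ in $\mathsf A$ then $p(\,\cdot\,|x,a_n)\to p(\,\cdot\,|x,a)$ setwise; (b) $\mathsf A$ is compact; (c) $c$ and $c_n$ ($n\ge 0$) are non-negative bounded measurable functions on $\mathsf X\times\mathsf A$ such that $c(x,\,\cdot\,)$ and $c_n(x,\,\cdot\,)$ are continuous and bounded on $\mathsf A$ for every $x\in\mathsf X$. Let $\pi\in S$ and let $\{\pi^k\}_{k\ge1}$ be the quantized approximations of $\pi$. Then, for every $\beta\in(0,1)$, $$w_\beta(\pi^k,\mu)\to w_\beta(\pi,\mu)\quad\text{as }k\to\infty .$$ If in addition (d) $\sup_{\tilde\pi\in S}\sum_{n=N+1}^{\infty}\gamma_n^{\tilde\pi,\mu}(c_n)\to 0$ as $N\to\infty$, then also $w_t(\pi^k,\mu)\to w_t(\pi,\mu)$ as $k\to\infty$.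
   Context: Markov decision process: the state space $\mathsf X$ and action space $\mathsf A$ are Polish (complete separable metric) spaces with Borel $\sigma$-algebras; every action in $\mathsf A$ is admissible in every state; $p(\,\cdot\,|x,a)$ is a stochastic kernel on $\mathsf X$ given $\mathsf X\times\mathsf A$ (transition probability); $\mu$ is an arbitrary fixed probability measure on $\mathsf X$ (initial distribution). ''Measurable'' means Borel measurable. $d_{\mathsf A}$ is the metric of $\mathsf A$. A deterministic stationary policy $\pi$ is given (induced) by a measurable function $f:\mathsf X\to\mathsf A$: at each time $n$ the action is $a_n=f(x_n)$. $S$ denotes the set of all deterministic stationary policies. For a policy $\pi$ and initial distribution $\mu$, $P^\pi_\mu$ (expectation $E^\pi_\mu$) is the probability measure on $(\mathsf X\times\mathsf A)^\infty$ given by the Ionescu Tulcea theorem, under which $x_0\sim\mu$, $a_n$ is chosen according to $\pi$, and $x_{n+1}\sim p(\,\cdot\,|x_n,a_n)$ given the past. $\gamma_n^{\pi,\mu}$ denotes the law of $(x_n,a_n)$ under $P^\pi_\mu$. For a measure $\nu$ and function $g$, $\nu(g)=\int g\,d\nu$. Measures $\nu_n\to\nu$ setwise means $\nu_n(B)\to\nu(B)$ for every measurable $B$. Costs: $w_t(\pi,\mu)=E^\pi_\mu\big[\sum_{n=0}^\infty c_n(x_n,a_n)\big]$ (total cost) and $w_\beta(\pi,\mu)=E^\pi_\mu\big[\sum_{n=0}^\infty\beta^n c(x_n,a_n)\big]$ (discounted cost), where $c,c_n:\mathsf X\times\mathsf A\to[0,\infty)$ are measurable. Quantized approximations: since $\mathsf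 A$ is compact, fix for each $k\ge1$ a finite set $\Lambda_k=\{a_1,\dots,a_{m_k}\}\subset\mathsf A$ with $\min_{1\le i\le m_k}d_{\mathsf A}(a,a_i)<1/k$ for all $a\in\mathsf A$. If $\pi\in S$ is induced by $f$, let $q_k:\mathsf X\to\Lambda_k$, $q_k(x)=\arg\min_{a\in\Lambda_k}d_{\mathsf A}(f(x),a)$, with ties broken so that $q_k$ is measurable. The policy $\pi^k\in S$ induced by $q_k$ is called the ($k$-th) quantized approximation of $\pi$. *)

(* Defs.v *)
From HB Require Import structures.
From mathcomp Require Import all_boot all_order all_algebra.
From mathcomp Require Import all_classical all_reals all_analysis.

Set Implicit Arguments.
Unset Strict Implicit.
Unset Printing Implicit Defensive.

Import Order.TTheory GRing.Theory Num.Theory.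
Import numFieldNormedType.Exports.

Local Open Scope classical_set_scope.
Local Open Scope ring_scope.

(* The product X * A of two Polish spaces carries the product sigma-algebra,
   which is its Borel sigma-algebra because both factors are separable. *)
HB.mixin Record isPolishBorel (R : realType) (d : measure_display) T
    & Measurable d T & Metric R T & Complete T := {
  polish_separable : exists2 D : set T, countable D & dense D ;
  polish_borel : @measurable d T = <<s [set U : set T | open U] >>
}.

#[short(type="polishType")]
HB.structure Definition Polish (R : realType) (d : measure_display) :=
  { T of Measurable d T & Metric R T & Complete T & isPolishBorel R d T }.

Section trajectories.
Context {R : realType} {dX dA : measure_display}.
Context {X : measurableType dX} {A : measurableType dA}.
Local Open Scope ereal_scope.

(* I n selects the times n whose coordinate (x_n, a_n) may be constrained. *)
Definition coordinate_sets (I : set nat) : set (set (nat -> X * A)) :=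
  [set E | exists n B, [/\ I n, measurable B & E = [set w | B (w n)]]].

Definition trajectory := g_sigma_algebraType (coordinate_sets setT).

Definition history (n : nat) : set (set (nat -> X * A)) :=
  <<s coordinate_sets [set i | (i <= n)%N] >>.

(* P is the law of the process started from mu, with transition law p, under
   the deterministic stationary policy induced by f.  These conditions determine
   P uniquely; existence is the Ionescu Tulcea theorem. *)
Definition is_policy_law (p : R.-pker (X * A) ~> X) (mu : probability X R)
    (f : {mfun X >-> A}) (P : probability trajectory R) : Prop :=
  [/\ forall B, measurable B -> P [set w | B (w 0%N).1] = mu B,
      forall n, {ae P, forall w, (w n).2 = f (w n).1} &
      forall n E B, history n E -> measurable B ->
        P (E `&` [set w | B (w n.+1).1]) = \int[P]_(w in E) p (w n) B].

(* The law of (x_n, a_n). *)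
Definition state_action_law (P : probability trajectory R) (n : nat) :
    set (X * A) -> \bar R :=
  pushforward P (fun w : trajectory => w n).

Definition total_cost (c : nat -> X * A -> R) (P : probability trajectory R) :
    \bar R :=
  \int[P]_w \sum_(0 <= n <oo) (c n (w n))%:E.

Definition discounted_cost (beta : R) (c : X * A -> R)
    (P : probability trajectory R) : \bar R :=
  \int[P]_w \sum_(0 <= n <oo) (beta ^+ n * c (w n))%:E.

Definition setwise_cvg (nu : nat -> set X -> \bar R) (nu0 : set X -> \bar R) :=
  forall B, measurable B -> nu n B @[n --> \oo] --> nu0 B.

End trajectories.
Arguments trajectory {dX dA} X A.

Section quantization.
Context {R : realType} {A : metricType R}.

(* The conditions on k >= 1 only: the value at k = 0 is irrelevant. *)
Definition quantization_nets (Lambda : nat -> set A) : Prop :=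
  forall k, (0 < k)%N -> finite_set (Lambda k) /\
    forall a, exists2 b, Lambda k b & mdist a b < k%:R^-1.

Definition nearest (L : set A) (a b : A) : Prop :=
  L b /\ forall b', L b' -> mdist a b <= mdist a b'.

End quantization.

Definition quantized_approximations {R : realType} {dX dA : measure_display}
    {X : measurableType dX} {A : polishType R dA} (Lambda : nat -> set A)
    (f : {mfun X >-> A}) (q : nat -> {mfun X >-> A}) : Prop :=
  forall k, (0 < k)%N -> forall x, nearest (Lambda k) (f x) (q k x).

(* Main.v *)
Require Import Defs.
From HB Require Import structures.
From mathcomp Require Import all_boot all_order all_algebra.
From mathcomp Require Import all_classical all_reals all_analysis.
From mathcomp Require Import measurable_realfun.
Import Order.TTheory GRing.Theory Num.Theory.
Import numFieldNormedType.Exports.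
Local Open Scope classical_set_scope.
Local Open Scope ring_scope.

(** As the nets get finer, q k converges pointwise to f.  Write l k n for the law
    of the n-th state under q k.  Everything follows from the setwise convergence
    of l k n to the law of the n-th state under f, as k grows, proved by induction
    on n (setwise_cvg_state_law): the next state has law
      l k n.+1 B = \int p (x, q k x) B d(l k n)(x),
    where, by the continuity of p in the action, the integrand converges
    pointwise, and where the integrating measure converges setwise.

    So the tool is a bounded convergence theorem in which the measure varies with
    the integrand (setwise_bounded_convergence).  Its core is Fatou's lemma for
    setwise convergent measures (setwise_fatou): the infimum of the integrands of
    index at least n is a fixed function, whose integral is lower semicontinuous
    along the measures because it is approximated from below by integrals of
    simple functions.  Applying it to h and to M - h gives both bounds.

    The same theorem gives the convergence of the n-th expected stage cost.  The
    total cost is the series of these, and a bound on the tails that is uniform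
    over the policies and tends to 0 allows the limit to be taken term by term
    (cvg_nneseries_uniform_tail).  The discounted cost is the total cost for the
    stage costs beta ^ n * c, whose tails are dominated by a geometric series. *)

(** * Sequences of extended reals *)

Section ereal_sequences.
Context {R : realType}.
Local Open Scope ereal_scope.
Implicit Types (a : nat -> \bar R) (l y : \bar R).

(** The two one-sided halves of convergence are what semicontinuity arguments
    deliver, and they cover infinite limits without a case distinction. *)
Lemma cvge_order a l :
    (forall y, y < l -> \forall k \near \oo, y < a k) ->
    (forall y, l < y -> \forall k \near \oo, a k < y) ->
  a @ \oo --> l.
Proof.
(* A neighbourhood of l contains an interval around l, each end of which is either
   infinite or open and on the strict side of l. *)
move=> lo hi U; rewrite itv_nbhsE => -[[i1 i2] [io li] /filterS]; apply.
have lb : \forall k \near \oo, (i1 <= BLeft (a k))%O.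
  case: i1 io li => [[] r|[]]; case: i2 => [[] s|[]] //= _;
    rewrite !in_itv/= ?andbT //; try (by move=> _; near=> k);
    do ?[move=> /andP[+ _]]; move=> /lo;
    by apply: filterS => k; rewrite bnd_simp.
have ub : \forall k \near \oo, (BRight (a k) <= i2)%O.
  case: i1 io li {lb} => [[] r|[]]; case: i2 => [[] s|[]] //= _;
    rewrite !in_itv/= ?andbT //; try (by move=> _; near=> k);
    do ?[move=> /andP[_ +]]; move=> /hi;
    by apply: filterS => k; rewrite bnd_simp.
apply: filterS2 lb ub => k lk uk.
by rewrite /= itv_boundlr lk.
Unshelve. all: by end_near. Qed.

Lemma cvge_near_gt a l y : a @ \oo --> l -> y < l ->
  \forall k \near \oo, y < a k.
Proof. by move=> al yl; exact: (al _ (open_ereal_gt' yl)). Qed.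

Lemma cvge_near_lt a l y : a @ \oo --> l -> l < y ->
  \forall k \near \oo, a k < y.
Proof. by move=> al ly; exact: (al _ (open_ereal_lt' ly)). Qed.

(** Partial sums converge term by term.  They bound the whole series from below,
    and from above once the uniform bound t N on the tail is added. *)
Lemma cvg_nneseries_uniform_tail (a : nat -> nat -> \bar R) (b : nat -> \bar R)
    (t : nat -> \bar R) :
    (forall k n, 0 <= a k n) -> (forall n, 0 <= b n) ->
    (forall n, a k n @[k --> \oo] --> b n) ->
    (forall k N, \sum_(N.+1 <= n <oo) a k n <= t N) ->
    t @ \oo --> 0 ->
  \sum_(0 <= n <oo) a k n @[k --> \oo] --> \sum_(0 <= n <oo) b n.
Proof.
move=> a0 b0 ab at_ t0.
have partial N :
    \sum_(0 <= n < N) a k n @[k --> \oo] --> \sum_(0 <= n < N) b n.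
  by apply: cvg_nnesum => n _; [exact: nearW|exact: ab].
have sumb : \sum_(0 <= n < N) b n @[N --> \oo] --> \sum_(0 <= n <oo) b n.
  exact: is_cvg_nneseries.
apply: cvge_order => y.
- move=> /(cvge_near_gt _ _ _ sumb)[N _ /(_ N (leqnn _)) yN].
  apply: filterS (cvge_near_gt _ _ _ (partial N) yN) => k yk.
  exact/(lt_le_trans yk)/nneseries_lim_ge.
- move=> by_.
  have bfin : \sum_(0 <= n <oo) b n \is a fin_num.
    by rewrite ge0_fin_numE ?nneseries_ge0// (lt_le_trans by_)// leey.
  have sumbt : \sum_(0 <= n < N.+1) b n + t N @[N --> \oo]
      --> \sum_(0 <= n <oo) b n.
    rewrite -[X in _ --> X]adde0; apply: cvgeD => //.
      by rewrite fin_num_adde_defl.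
    by rewrite (cvg_shiftS (fun N => \sum_(0 <= n < N) b n)).
  have [N _ /(_ N (leqnn _)) /= Ny] := cvge_near_lt _ _ _ sumbt by_.
  have sN0 : 0 <= \sum_(0 <= n < N.+1) b n by apply: sume_ge0.
  have tN0 : 0 <= t N by apply: le_trans (at_ 0%N N); apply: nneseries_ge0.
  have tNfin : t N \is a fin_num.
    rewrite ge0_fin_numE//; apply: le_lt_trans (leeDr _ sN0) _.
    exact/(lt_le_trans Ny)/leey.
  have : \sum_(0 <= n < N.+1) a k n + t N @[k --> \oo]
      --> \sum_(0 <= n < N.+1) b n + t N.
    apply: cvgeD; [by rewrite fin_num_adde_defl|exact: partial|exact: cvg_cst].
  move=> /cvge_near_lt/(_ Ny); apply: filterS => k; apply: le_lt_trans.
  rewrite (nneseries_split 0 N.+1)// add0n leeD2l//; exact: at_.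
Qed.

End ereal_sequences.

(** * Integration along setwise convergent measures *)

Section setwise_convergence.
Context {d : measure_display} {T : measurableType d} {R : realType}.
Variables (m : nat -> probability T R) (m0 : probability T R).
Hypothesis mm0 : setwise_cvg m m0.
Local Open Scope ereal_scope.
Import HBNNSimple.

Lemma setwise_cvg_nnsfun (g : {nnsfun T >-> R}) :
  \int[m k]_x (g x)%:E @[k --> \oo] --> \int[m0]_x (g x)%:E.
Proof.
under eq_fun do rewrite integralT_nnsfun sintegralE fsbig_finite//=.
rewrite integralT_nnsfun sintegralE fsbig_finite//=.
apply: cvg_nnesum => r _.
  by apply: nearW => k; exact: nnsfun_mulemu_ge0.
by apply: cvgeZl => //; apply: mm0; exact: measurable_sfunP.
Qed.

(** An integral exceeding y is already exceeded by that of a simple function below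
    u, and simple functions see only finitely many sets. *)
Lemma setwise_lsc (u : T -> \bar R) (y : \bar R) :
    measurable_fun setT u -> (forall x, 0 <= u x) ->
    y < \int[m0]_x u x -> \forall k \near \oo, y < \int[m k]_x u x.
Proof.
move=> mu u0 yu.
pose g := nnsfun_approx measurableT mu.
have gu x : (g n x)%:E @[n --> \oo] --> u x by exact: cvg_nnsfun_approx.
have mg n : measurable_fun setT (fun x => (g n x)%:E) by exact/measurable_EFinP.
have nd x : nondecreasing_seq (fun n => (g n x)%:E).
  by move=> i j ij; rewrite lee_fin; exact/lefP/nd_nnsfun_approx.
have cg : \int[m0]_x (g n x)%:E @[n --> \oo] --> \int[m0]_x u x.
  under [X in _ --> X]eq_integral do rewrite -(cvg_lim _ (gu _))//.
  by apply: cvg_monotone_convergence => // n x _; rewrite lee_fin.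
have [n _ /(_ n (leqnn _)) yn] := cvge_near_gt _ _ _ cg yu.
apply: filterS (cvge_near_gt _ _ _ (setwise_cvg_nnsfun (g n)) yn) => k yk.
apply: (lt_le_trans yk); apply: ge0_le_integral => //.
- by move=> x _; rewrite lee_fin.
- move=> x _; rewrite -(cvg_lim _ (gu x))//.
  apply: lime_ge; first exact: ereal_nondecreasing_is_cvgn.
  by exists n => // j; exact: nd.
Qed.

(** The infimum u n of the h k over k >= n does not depend on k and increases to
    h0 with n, so the case of a fixed integrand applies to a u n with n large. *)
Lemma setwise_fatou (h : nat -> T -> \bar R) (h0 : T -> \bar R) (y : \bar R) :
    (forall k, measurable_fun setT (h k)) -> (forall k x, 0 <= h k x) ->
    (forall x, h k x @[k --> \oo] --> h0 x) ->
    y < \int[m0]_x h0 x -> \forall k \near \oo, y < \int[m k]_x h k x.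
Proof.
move=> mh h_ge0 hh0 yh.
pose u n x := einfs (h ^~ x) n.
have mu n : measurable_fun setT (u n) by exact: measurable_fun_einfs.
have u_ge0 n x : 0 <= u n x.
  by apply: le_ereal_inf_tmp => _ [i /= ni <-]; exact: h_ge0.
have cu : \int[m0]_x u n x @[n --> \oo] --> \int[m0]_x h0 x.
  under [X in _ --> X]eq_integral
    do rewrite -(cvg_lim _ (cvg_einfs (hh0 _)))//.
  apply: cvg_monotone_convergence => //; first by move=> n x _; exact: u_ge0.
  by move=> x _; exact: nondecreasing_einfs.
have [n _ /(_ n (leqnn _)) yn] := cvge_near_gt _ _ _ cu yh.
near=> k.
have yk : y < \int[m k]_x u n x.
  by near: k; exact: setwise_lsc.
apply: (lt_le_trans yk); apply: ge0_le_integral => // x _.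
apply: ereal_inf_lbound; exists k => //=.
by near: k; exact: nbhs_infty_ge.
Unshelve. all: by end_near. Qed.

(** Fatou's lemma for h k bounds the integrals from below.  For M - h k it bounds
    them from above, since M has the same integral for every probability. *)
Lemma setwise_bounded_convergence (h : nat -> T -> \bar R) (h0 : T -> \bar R)
    (M : R) :
    (forall k, measurable_fun setT (h k)) -> measurable_fun setT h0 ->
    (forall k x, 0 <= h k x <= M%:E) -> (forall x, 0 <= h0 x <= M%:E) ->
    (forall x, h k x @[k --> \oo] --> h0 x) ->
  \int[m k]_x h k x @[k --> \oo] --> \int[m0]_x h0 x.
Proof.
move=> mh mh0 hM h0M hh0.
have finM (v : \bar R) : 0 <= v <= M%:E -> v \is a fin_num.
  by move=> /andP[v0 vM]; rewrite ge0_fin_numE// (le_lt_trans vM)// ltry.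
have complement (P : probability T R) (g : T -> \bar R) : measurable_fun setT g ->
    (forall x, 0 <= g x <= M%:E) ->
    \int[P]_x g x \is a fin_num /\
    \int[P]_x (M%:E - g x) = M%:E - \int[P]_x g x.
  move=> mg gM.
  have gfin x : g x \is a fin_num by exact: finM.
  have g0 x : 0 <= g x by case/andP: (gM x).
  have Mg0 x : 0 <= M%:E - g x.
    by rewrite suber_ge0//; case/andP: (gM x).
  have intM : \int[P]_x (M%:E - g x) + \int[P]_x g x = M%:E.
    rewrite -ge0_integralD//.
    - rewrite -[RHS]mule1 -(@probability_setT _ _ _ P) -integral_cst//.
      by apply: eq_integral => x _; rewrite subeK.
    - exact: emeasurable_funB.
  have int0 : 0 <= \int[P]_x g x.
    by apply: integral_ge0 => x _.
  have int0' : 0 <= \int[P]_x (M%:E - g x).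
    by apply: integral_ge0 => x _.
  have fin : \int[P]_x g x \is a fin_num.
    by apply: finM; rewrite int0 -intM leeDr.
  by split=> //; rewrite -[X in _ = X - _]intM addeK.
apply: cvge_order => y.
  by apply: setwise_fatou => // k x; case/andP: (hM k x).
move=> hy.
have [fin0 ref0] := complement m0 h0 mh0 h0M.
case: y hy => [r hr|_|]; [| |by rewrite ltNge leNye]; last first.
  apply: nearW => k.
  by have [fink _] := complement (m k) (h k) (mh k) (hM k); rewrite ltey_eq fink.
have : (M - r)%:E < \int[m0]_x (M%:E - h0 x).
  by rewrite ref0 -(fineK fin0) -EFinB lte_fin ltrD2l ltrN2 -lte_fin fineK.
move/(@setwise_fatou (fun k x => M%:E - h k x)) => near_gt.
have {}near_gt : \forall k \near \oo, (M - r)%:E < \int[m k]_x (M%:E - h k x).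
  apply: near_gt.
  - by move=> k; exact: emeasurable_funB.
  - by move=> k x; rewrite suber_ge0 ?finM//; case/andP: (hM k x).
  - move=> x; by apply: cvgeB => //; exact: cvg_cst.
apply: filterS near_gt => k.
have [fink ->] := complement (m k) (h k) (mh k) (hM k).
by rewrite -(fineK fink) -EFinB !lte_fin ltrD2l ltrN2.
Qed.

End setwise_convergence.

(** * State laws and stage costs under a stationary policy *)

Section policy_laws.
Context {R : realType} {dX dA : measure_display}.
Context {X : measurableType dX} {A : measurableType dA}.

Lemma measurable_coordinate n :
  measurable_fun setT (fun w : trajectory X A => w n).
Proof.
move=> _ B mB; rewrite setTI; apply: sub_sigma_algebra.
by exists n, B.
Qed.

Definition state n (w : trajectory X A) : X := (w n).1.

Lemma measurable_state n : measurable_fun setT (state n).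
Proof. exact: measurableT_comp (measurable_coordinate n). Qed.

HB.instance Definition _ n :=
  isMeasurableFun.Build _ _ _ _ (state n) (measurable_state n).

Variables (p : R.-pker (X * A) ~> X) (mu : probability X R).
Local Open Scope ereal_scope.

(** The action is a function of the state almost surely, hence expectations at
    time n only involve the law of the n-th state. *)
Lemma integral_state_action (f : {mfun X >-> A})
    (P : probability (trajectory X A) R) n (h : X * A -> \bar R) :
    is_policy_law p mu f P -> measurable_fun setT h -> (forall z, 0 <= h z) ->
  \int[P]_w h (w n) = \int[distribution P (state n)]_x h (x, f x).
Proof.
move=> [_ Pf _] mh h0.
have mhf : measurable_fun setT (fun x => h (x, f x)).
  exact/(measurableT_comp mh)/measurable_fun_pair.
rewrite ge0_integral_distribution//.
apply: ge0_ae_eq_integral => //.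
- exact: measurableT_comp (measurable_coordinate n).
- exact: measurableT_comp (measurable_state n).
- by move=> w _; exact: h0.
- apply: (@filterS _ _ (ae_filter_ringOfSetsType P) _ _ _ (Pf n)) => w wf _ /=.
  by rewrite /state -wf -surjective_pairing.
Qed.

Lemma state_law0 f P B : is_policy_law p mu f P -> measurable B ->
  distribution P (state 0) B = mu B.
Proof. by move=> [+ _ _]; exact. Qed.

(** The Markov property, for the trivial event of the past. *)
Lemma state_lawS f P n B : is_policy_law p mu f P -> measurable B ->
  distribution P (state n.+1) B =
  \int[distribution P (state n)]_x p (x, f x) B.
Proof.
move=> Pf mB; have [_ _ Pp] := Pf.
rewrite -(integral_state_action _ _ n (fun z => p z B) Pf)//; last first.
  exact: measurable_kernel.
rewrite -Pp//; first by rewrite setTI.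
by apply: sub_sigma_algebra; exists 0%N, setT.
Qed.

Section continuity.
Variables (q : nat -> {mfun X >-> A}) (f : {mfun X >-> A}).
Variables (Q : nat -> probability (trajectory X A) R).
Variables (P : probability (trajectory X A) R).
Hypothesis hQ : forall k, is_policy_law p mu (q k) (Q k).
Hypothesis hP : is_policy_law p mu f P.
Hypothesis pq : forall x, setwise_cvg (fun k => p (x, q k x)) (p (x, f x)).

(** In the induction step both the integrand p (x, q k x) B and the law of x vary
    with k, which is why bounded convergence is needed for varying measures. *)
Lemma setwise_cvg_state_law n :
  setwise_cvg (fun k => distribution (Q k) (state n)) (distribution P (state n)).
Proof.
elim: n => [B mB|n IHn B mB].
  rewrite (state_law0 f)//; under eq_fun do rewrite (state_law0 _ _ _ (hQ _))//.
  exact: cvg_cst.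
rewrite (state_lawS f)//; under eq_fun do rewrite (state_lawS _ _ _ _ (hQ _))//.
have mpg (g : {mfun X >-> A}) : measurable_fun setT (fun x => p (x, g x) B).
  apply: (measurableT_comp (measurable_kernel p B mB)).
  exact: measurable_fun_pair.
have pg1 (g : {mfun X >-> A}) x : 0 <= p (x, g x) B <= 1%:E.
  rewrite measure_ge0/= -(@prob_kernel _ _ _ _ _ p (x, g x)).
  by apply: le_measure; rewrite ?inE.
apply: (setwise_bounded_convergence _ _ IHn _ _ 1%R) => // x.
exact: pq.
Qed.

Lemma cvg_stage_cost n (c : X * A -> R) (M : R) :
    measurable_fun setT c -> (forall z, (0 <= c z <= M)%R) ->
    (forall x, (c (x, q k x) @[k --> \oo] --> c (x, f x))%R) ->
  \int[Q k]_w (c (w n))%:E @[k --> \oo] --> \int[P]_w (c (w n))%:E.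
Proof.
move=> mc cM cq.
have mcE : measurable_fun setT (fun z => (c z)%:E) by exact/measurable_EFinP.
have c0 z : 0 <= (c z)%:E by rewrite lee_fin; case/andP: (cM z).
rewrite (integral_state_action _ _ n (fun z => (c z)%:E) hP)//.
under eq_fun do rewrite
  (integral_state_action _ _ n (fun z => (c z)%:E) (hQ _))//.
have mcg (g : {mfun X >-> A}) : measurable_fun setT (fun x => (c (x, g x))%:E).
  exact/(measurableT_comp mcE)/measurable_fun_pair.
apply: (setwise_bounded_convergence _ _ (setwise_cvg_state_law n) _ _ M) => //.
- by move=> k x; rewrite !lee_fin.
- by move=> x; rewrite !lee_fin.
- by move=> x; apply: cvg_EFin; [exact: nearW|exact: cq].
Qed.

End continuity.

Lemma total_costE (c : nat -> X * A -> R) (P : probability (trajectory X A) R) :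
    (forall n, measurable_fun setT (c n)) -> (forall n z, (0 <= c n z)%R) ->
  total_cost c P = \sum_(0 <= n <oo) \int[P]_w (c n (w n))%:E.
Proof.
move=> mc c0; rewrite /total_cost integral_nneseries//.
- move=> n; apply/measurable_EFinP.
  exact: measurableT_comp (measurable_coordinate n).
- by move=> n w _; rewrite lee_fin.
Qed.

Lemma integral_state_action_law (c : X * A -> R)
    (P : probability (trajectory X A) R) n :
    measurable_fun setT c -> (forall z, (0 <= c z)%R) ->
  \int[state_action_law P n]_z (c z)%:E = \int[P]_w (c (w n))%:E.
Proof.
move=> mc c0; rewrite ge0_integral_pushforward//.
- exact: measurable_coordinate.
- exact/measurable_EFinP.
- by move=> z _; rewrite lee_fin.
Qed.

End policy_laws.

(** * Convergence of the costs *)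

Lemma quantized_cvg {R : realType} {dX dA : measure_display}
    {X : measurableType dX} {A : polishType R dA} {Lambda : nat -> set A}
    {f : {mfun X >-> A}} {q : nat -> {mfun X >-> A}} :
    quantization_nets Lambda -> quantized_approximations Lambda f q ->
  forall x, q k x @[k --> \oo] --> f x.
Proof.
move=> hL hq x; apply/cvg_ballP => e e0; rewrite ballEmdist.
near=> k.
have k0 : (0 < k)%N by near: k; exact: nbhs_infty_gt.
have [b Lb fb] := (hL k k0).2 (f x).
apply: (le_lt_trans ((hq k k0 x).2 b Lb)); apply: (lt_trans fb).
rewrite -[e]invrK ltf_pV2 ?posrE ?invr_gt0 ?ltr0n//.
near: k; exact: nbhs_infty_gtr.
Unshelve. all: by end_near. Qed.


Theorem mainTheorem1 (R : realType) (dX dA : measure_display)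
    (X : polishType R dX) (A : polishType R dA)
    (p : R.-pker (X * A) ~> X) (mu : probability X R)
    (P : {mfun X >-> A} -> probability (trajectory X A) R)
    (hP : forall f, is_policy_law p mu f (P f))
    (c : X * A -> R) (cn : nat -> X * A -> R)
    (ha : forall (x : X) (u : nat -> A) (a : A), u n @[n --> \oo] --> a ->
      setwise_cvg (fun n => p (x, u n)) (p (x, a)))
    (hb : compact [set: A])
    (hc_meas : measurable_fun setT c)
    (hc_ge0 : forall z, 0 <= c z)
    (hc_bnd : exists M : R, forall z, c z <= M)
    (hc_cont : forall x, continuous (fun a => c (x, a)))
    (hcn_meas : forall n, measurable_fun setT (cn n))
    (hcn_ge0 : forall n z, 0 <= cn n z)
    (hcn_bnd : forall n, exists M : R, forall z, cn n z <= M)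
    (hcn_cont : forall n x, continuous (fun a => cn n (x, a)))
    (Lambda : nat -> set A) (hLambda : quantization_nets Lambda)
    (f : {mfun X >-> A}) (q : nat -> {mfun X >-> A})
    (hq : quantized_approximations Lambda f q) :
  (forall beta : R, 0 < beta < 1 ->
    discounted_cost beta c (P (q k)) @[k --> \oo]
      --> discounted_cost beta c (P f))
  /\
  ((ereal_sup [set (\sum_(N.+1 <= n <oo)
        \int[state_action_law (P g) n]_z (cn n z)%:E)%E | g in [set: {mfun X >-> A}]])
      @[N --> \oo] --> 0%E ->
    total_cost cn (P (q k)) @[k --> \oo] --> total_cost cn (P f)).
Proof.
have qf := quantized_cvg hLambda hq.
have pq x : setwise_cvg (fun k => p (x, q k x)) (p (x, f x)).
  exact/ha/qf.
(* Both parts are instances of this, the first one for b n = beta ^ n * c. *)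
have total (b : nat -> X * A -> R) :
    (forall n, measurable_fun setT (b n)) -> (forall n z, 0 <= b n z) ->
    (forall n, exists M : R, forall z, b n z <= M) ->
    (forall n x, continuous (fun a => b n (x, a))) ->
    (exists2 t : nat -> \bar R, t @ \oo --> 0%E & forall k N,
      (\sum_(N.+1 <= n <oo) \int[P (q k)]_w (b n (w n))%:E <= t N)%E) ->
  total_cost b (P (q k)) @[k --> \oo] --> total_cost b (P f).
  move=> mb b0 bM bcont [t t0 tail].
  rewrite total_costE//; under eq_fun do rewrite total_costE//.
  apply: (cvg_nneseries_uniform_tail _ _ t) => //.
  - by move=> k n; apply: integral_ge0 => w _; rewrite lee_fin.
  - by move=> n; apply: integral_ge0 => w _; rewrite lee_fin.
  - move=> n; have [M bnM] := bM n.
    apply: (cvg_stage_cost p mu q f (fun k => P (q k)) (P f) _ _ _ n _ M) => //.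
    + by move=> z; rewrite b0 bnM.
    + by move=> x; exact: continuous_cvg (bcont n x _) (qf x).
split.
- (* t N is the tail of the geometric series with ratio beta and factor M. *)
  move=> beta /andP[beta0 beta1].
  have [M' cM'] := hc_bnd; pose M := `|M'|.
  have M0 : 0 <= M by exact: normr_ge0.
  have cM z : c z <= M by exact: le_trans (cM' z) (ler_norm _).
  apply: (total (fun n z => beta ^+ n * c z)).
  + by move=> n; exact: measurable_funM.
  + by move=> n z; rewrite mulr_ge0// exprn_ge0// ltW.
  + move=> n; exists (beta ^+ n * M) => z.
    by rewrite ler_wpM2l// exprn_ge0// ltW.
  + by move=> n x a; apply: cvgM; [exact: cvg_cst|exact: hc_cont].
  + exists (fun N => \sum_(N.+1 <= n <oo) (beta ^+ n * M)%:E)%E.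
      rewrite (cvg_shiftS (fun N => \sum_(N <= n <oo) (beta ^+ n * M)%:E)%E).
      apply: nneseries_tail_cvg; last first.
        by move=> n _; rewrite lee_fin mulr_ge0// exprn_ge0// ltW.
      have gs : series (geometric M beta) @ \oo --> M * (1 - beta)^-1.
        by apply: cvg_geometric_series; rewrite ger0_norm// ltW.
      rewrite (_ : (fun _ => _) = EFin \o series (geometric M beta)).
        rewrite (cvg_lim _ (cvg_EFin _ gs)) ?ltry//; exact: nearW.
      apply/funext => n /=; rewrite -sumEFin /series/=.
      by apply: eq_bigr => i _; rewrite mulrC.
    move=> k N; apply: lee_nneseries => [n _ _|n _].
      apply: integral_ge0 => w _.
      by rewrite lee_fin mulr_ge0// exprn_ge0// ltW.
    rewrite -[leRHS]mule1 -(@probability_setT _ _ _ (P (q k))) -integral_cst//.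
    apply: ge0_le_integral => //.
    * by move=> w _; rewrite lee_fin mulr_ge0// exprn_ge0// ltW.
    * apply/measurable_EFinP/measurable_funM => //.
      exact: measurableT_comp (measurable_coordinate n).
    * by move=> w _; rewrite lee_fin ler_wpM2l// exprn_ge0// ltW.
- (* t N is the supremum over all policies, of which the q k are instances. *)
  move=> tail0; apply: total => //.
  eexists; first exact: tail0.
  move=> k N; apply: ereal_sup_ubound; exists (q k) => //.
  by apply: eq_eseriesr => n _; rewrite integral_state_action_law.
Qed.
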